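(* The following equality in law holds conditionally on $\{\lambda_1,\dots,\lambda_N\}$: $$\mathscr{O}_{11}\overset{(d)}{=}\prod_{n=2}^N\left(1+\frac{|X_n|^2}{N|\lambda_1-\lambda_n|^2}\right),$$ where $X_2,\dots,X_N$ are independent standard complex Gaussian random variables.
   Context: Let $G=G_N$ be an $N\times N$ complex Ginibre matrix: its entries are i.i.d. centered complex Gaussians with density $\frac{N}{\pi}e^{-N|w|^2}$ with respect to Lebesgue measure on $\mathbb{C}$ (so $\mathbb{E}|G_{ij}|^2=1/N$). Its eigenvalues are a.s. distinct and are labelled exchangeably, so that $(\lambda_1,\dots,\lambda_N)$ has joint density proportional to $\prod_{j<k}|\lambda_j-\lambda_k|^2\prod_k e^{-N|\lambda_k|^2}$. Let $R_i$, $L_i$ be column vectors with $GR_i=\lambda_iR_i$, $L_i^{t}G=\lambda_iL_i^{t}$, normalized by $L_i^{t}R_j=\delta_{ij}$. The diagonal overlap is $\mathscr{O}_{11}=\|R_1\|^2\|L_1\|^2$; it does not depend on the remaining choice of scaling. Conditioning on all the eigenvalues means: the overlaps are distributed as those of the upper triangular matrix $T$ (Schur form of $G$) with the given distinct eigenvalues $\lambda_1,\dots,\lambda_N$ on the diagonal and with independent centered complex Gaussian entries of variance $1/N$ (same law as $G_{ij}$) strictly above the diagonal. A standard complex Gaussian is $\frac{1}{\sqrt2}(\mathscr{N}_1+i\mathscr{N}_2)$ with $\mathscr{N}_1,\mathscr{N}_2$ independent standard real Gaussians. *)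

(* Defs.v *)
From HB Require Import structures.
From mathcomp Require Import all_boot all_order all_algebra.
From mathcomp Require Import all_classical all_reals all_analysis.
From mathcomp Require Import complex.
Import Order.TTheory GRing.Theory Num.Theory ComplexField.
Import numFieldNormedType.Exports.

Set Implicit Arguments.
Unset Strict Implicit.
Unset Printing Implicit Defensive.

Local Open Scope classical_set_scope.
Local Open Scope ring_scope.
Local Open Scope complex_scope.

(* C carries no sigma-algebra in the libraries; a C-valued map is handled
   through the identification of C with R * R (product Borel sigma-algebra). *)
Definition reim (R : realType) (z : R[i]) : R * R := (complex.Re z, complex.Im z).

Definition complex_random_variable d (Omega : measurableType d) (R : realType)
    (Z : Omega -> R[i]) : Prop :=
  measurable_fun [set: Omega] (@reim R \o Z).

(* Mutual independence of the subfamily (X i), i satisfying D. *)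
Definition mutually_independent d (Omega : measurableType d) (R : realType)
    (P : probability Omega R) d' (S : measurableType d') (I : finType)
    (D : pred I) (X : I -> Omega -> S) : Prop :=
  forall (J : {set I}) (A : I -> set S),
    (forall i, i \in J -> D i) -> (forall i, measurable (A i)) ->
    P (\bigcap_(i in [set i | i \in J]) (X i @^-1` A i)) =
    (\prod_(i in J) P (X i @^-1` A i))%E.

Definition ginibre_pdf (R : realType) (N : nat) (w : R * R) : R :=
  N%:R / pi * expR (- (N%:R * Normc.normc (w.1 +i* w.2) ^+ 2)).

(* Z has the law of an entry of the N x N complex Ginibre matrix. *)
Definition ginibre_entry d (Omega : measurableType d) (R : realType)
    (P : probability Omega R) (N : nat) (Z : Omega -> R[i]) : Prop :=
  complex_random_variable Z /\
  forall A : set (R * R), measurable A ->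
    P (Z @^-1` (@reim R @^-1` A)) =
    (\int[(@lebesgue_measure R \x @lebesgue_measure R)%E]_(w in A)
       (ginibre_pdf N w)%:E)%E.

Definition standard_real_gaussian d (Omega : measurableType d) (R : realType)
    (P : probability Omega R) (X : {RV P >-> R}) : Prop :=
  forall A : set R, measurable A -> distribution P X A = normal_prob 0 1 A.

Definition standard_complex_gaussian d (Omega : measurableType d)
    (R : realType) (P : probability Omega R) (Z : Omega -> R[i]) : Prop :=
  exists N1 N2 : {RV P >-> R},
    [/\ standard_real_gaussian N1, standard_real_gaussian N2,
        (forall A B : set R, measurable A -> measurable B ->
           P (N1 @^-1` A `&` N2 @^-1` B) =
           (P (N1 @^-1` A) * P (N2 @^-1` B))%E)
      & forall omega,
          Z omega = (Num.sqrt 2)^-1%:C * ((N1 omega)%:C + 'i * (N2 omega)%:C)].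

(* T is the Schur form of a Ginibre matrix given its eigenvalues lam. *)
Definition ginibre_schur_form d (Omega : measurableType d) (R : realType)
    (P : probability Omega R) (N : nat) (lam : 'I_N -> R[i])
    (T : Omega -> 'M[R[i]]_N) : Prop :=
  [/\ forall omega i, T omega i i = lam i,
      forall omega (i j : 'I_N), (j < i)%N -> T omega i j = 0,
      forall i j : 'I_N, (i < j)%N ->
        ginibre_entry P N (fun omega => T omega i j)
    & mutually_independent P (fun ij : 'I_N * 'I_N => (ij.1 < ij.2)%N)
        (fun ij omega => reim (T omega ij.1 ij.2))].

Definition biorthogonal_eigenvectors (R : realType) (N : nat)
    (M : 'M[R[i]]_N) (lam : 'I_N -> R[i]) (Rv Lv : 'I_N -> 'cV[R[i]]_N)
    : Prop :=
  [/\ forall i, M *m Rv i = lam i *: Rv i,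
      forall i, (Lv i)^T *m M = lam i *: (Lv i)^T
    & forall i j, (Lv i)^T *m Rv j = (i == j)%:R%:M].

Definition sqnorm (R : realType) (N : nat) (v : 'cV[R[i]]_N) : R :=
  \sum_(k < N) Normc.normc (v k 0) ^+ 2.

Definition diagonal_overlap (R : realType) (N : nat)
    (Rv Lv : 'I_N -> 'cV[R[i]]_N) (i : 'I_N) : R :=
  sqnorm (Rv i) * sqnorm (Lv i).

Definition eq_in_law d1 (Omega1 : measurableType d1) d2
    (Omega2 : measurableType d2) (R : realType)
    (P1 : probability Omega1 R) (P2 : probability Omega2 R)
    (X1 : Omega1 -> R) (X2 : Omega2 -> R) : Prop :=
  [/\ measurable_fun [set: Omega1] X1,
      measurable_fun [set: Omega2] X2
    & forall A : set R, measurable A -> P1 (X1 @^-1` A) = P2 (X2 @^-1` A)].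

(* Main.v *)
(* The matrix being upper triangular with distinct diagonal entries, R_1 is
   supported on the first coordinate and L_1 is proportional to
   (1, b_2, ..., b_N) with
   (lambda_1 - lambda_k) b_k = sum_(i < k) b_i T_ik, so that the overlap is
   S_N where S_k = sum_(i <= k) |b_i|^2.  The b_i with i < k depend only on the
   columns of T before k; integrating out the entries of column k one at a
   time, the isotropy of complex Gaussians turns b_k into a complex Gaussian of
   variance S_(k-1) / (N |lambda_1 - lambda_k|^2) given those columns.  Hence
   S_k = S_(k-1) (1 + |X_k|^2 / (N |lambda_1 - lambda_k|^2)) in law, with X_k
   independent of S_(k-1), and an induction on k tested against an arbitrary
   nonnegative measurable function of S_k concludes. *)
Require Import Defs.
From HB Require Import structures.
From mathcomp Require Import all_boot all_order all_algebra.
From mathcomp Require Import all_classical all_reals all_analysis measurable_realfun.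
From mathcomp Require Import complex ring lra.
Import Order.TTheory GRing.Theory Num.Theory ComplexField.
Import numFieldNormedType.Exports.

Local Open Scope classical_set_scope.
Local Open Scope ring_scope.
Local Open Scope complex_scope.

(** Descends through pairs, projections and ring operations, leaving the other maps as goals. The
    subtraction pattern comes before the addition one, since a difference is a sum with an
    opposite. *)
Ltac measurable_arith := cbv beta; lazymatch goal with
  | |- measurable_fun _ (fun x => (@?f x, @?g x)) =>
      apply: (@measurable_fun_pair _ _ _ _ _ _ f g); measurable_arith
  | |- measurable_fun _ (fun x => @GRing.add _ (@?f x) (@GRing.opp _ (@?g x))) =>
      apply: (@measurable_funB _ _ _ _ f g); measurable_arith
  | |- measurable_fun _ (fun x => @GRing.add _ (@?f x) (@?g x)) =>
      apply: (@measurable_funD _ _ _ _ f g); measurable_arith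
  | |- measurable_fun _ (fun x => @GRing.mul _ (@?f x) (@?g x)) =>
      apply: (@measurable_funM _ _ _ _ f g); measurable_arith
  | |- measurable_fun _ (fun x => @GRing.exp _ (@?f x) ?n) =>
      apply: (@measurable_funX _ _ _ _ f n); measurable_arith
  | |- measurable_fun _ (fun x => x) => exact: measurable_id
  | |- measurable_fun _ (fun x => fst x) => exact: measurable_fst
  | |- measurable_fun _ (fun x => snd x) => exact: measurable_snd
  | |- measurable_fun _ (fun x => fst (@?f x)) =>
      apply: (measurableT_comp measurable_fst (g := f)); measurable_arith
  | |- measurable_fun _ (fun x => snd (@?f x)) =>
      apply: (measurableT_comp measurable_snd (g := f)); measurable_arith
  | |- measurable_fun _ (fun _ => ?c) => exact: measurable_cst
  | _ => idtac
  end.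

(** * Planar Lebesgue measure under shears and rotations *)

Section planar_lebesgue.
Context {R : realType}.
Local Notation mu := (@lebesgue_measure R).
Implicit Types (a b c s t : R).

Lemma measurable_affine a b :
  measurable_fun [set: R] (fun x : R => a * x + b : measurableTypeR R).
Proof.
by apply: measurable_funD => //; exact: measurable_funM.
Qed.

(** By uniqueness of Lebesgue measure: the rescaled pushforward gives each half-open interval its
    length. *)
Lemma lebesgue_measure_affine a b (A : set R) : 0 < a -> measurable A ->
  mu A = (a%:E * mu ((fun x : R => (a * x + b)%R) @^-1` A))%E.
Proof.
move=> a0 mA.
pose f (x : R) : measurableTypeR R := a * x + b.
have mf : measurable_fun [set: R] f by exact: measurable_affine.
apply: (@lebesgue_measure_unique R
  (mscale (NngNum (ltW a0)) (pushforward mu f))) => // _ [[u v]] _ <-/=.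
rewrite /mscale/= /pushforward/=.
have -> : f @^-1` `]u, v] = `](u - b) / a, (v - b) / a]%classic.
  apply/seteqP; split => x /=; rewrite !in_itv/=;
  by rewrite ltr_pdivrMr// ler_pdivlMr// ltrBlDr lerBrDr mulrC.
rewrite !lebesgue_measure_itv/= !lte_fin ltr_pM2r ?invr_gt0// ltrD2r.
case: ifPn => _; last by rewrite mule0.
rewrite -!EFinB -EFinM; congr EFin; field; lra.
Qed.

Lemma ge0_integral_affine a b (f : R -> \bar R) : 0 < a ->
  measurable_fun [set: R] f -> (forall x, 0 <= f x)%E ->
  (\int[mu]_x f x = a%:E * \int[mu]_x f (a * x + b)%R)%E.
Proof.
move=> a0 mf f0.
pose g (x : R) : measurableTypeR R := a * x + b.
have mg : measurable_fun [set: measurableTypeR R] g by exact: measurable_affine.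
rewrite -[in RHS](ge0_integral_pushforward mg mu measurableT mf)//.
rewrite -(ge0_integral_mscale _ measurableT (NngNum (ltW a0)))//.
apply: eq_measure_integral => A mA _.
exact: lebesgue_measure_affine.
Qed.

Lemma ge0_integral_shift b (f : R -> \bar R) :
  measurable_fun [set: R] f -> (forall x, 0 <= f x)%E ->
  (\int[mu]_x f (x + b)%R = \int[mu]_x f x)%E.
Proof.
move=> mf f0; rewrite [RHS](ge0_integral_affine 1 b)// mul1e.
by under [RHS]eq_integral do rewrite mul1r.
Qed.

Implicit Types h : R * R -> \bar R.

(** Tonelli with the sheared coordinate innermost: for fixed [z.2] the shear is a translation of
    [z.1]. *)
Lemma ge0_integral_shear1 t h :
  measurable_fun [set: R * R] h -> (forall z, 0 <= h z)%E ->
  (\int[mu \x mu]_z h (z.1 + t * z.2, z.2)%R = \int[mu \x mu]_z h z)%E.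
Proof.
move=> mh h0.
have mh' : measurable_fun [set: R * R] (fun z => h (z.1 + t * z.2, z.2)).
  by apply: measurableT_comp => //; measurable_arith.
apply: (etrans (fubini_tonelli2 (m1 := mu) (m2 := mu) _ mh' (fun=> h0 _))).
apply: (etrans _ (esym (fubini_tonelli2 (m1 := mu) (m2 := mu) _ mh h0))).
apply: eq_integral => y _; rewrite /fubini_G/=.
rewrite (ge0_integral_shift (t * y) (fun x => h (x, y)))//.
by apply: measurableT_comp => //; measurable_arith.
Qed.

Lemma ge0_integral_shear2 t h :
  measurable_fun [set: R * R] h -> (forall z, 0 <= h z)%E ->
  (\int[mu \x mu]_z h (z.1, z.2 + t * z.1)%R = \int[mu \x mu]_z h z)%E.
Proof.
move=> mh h0.
have mh' : measurable_fun [set: R * R] (fun z => h (z.1, z.2 + t * z.1)).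
  by apply: measurableT_comp => //; measurable_arith.
apply: (etrans (fubini_tonelli1 (m1 := mu) (m2 := mu) _ mh' (fun=> h0 _))).
apply: (etrans _ (esym (fubini_tonelli1 (m1 := mu) (m2 := mu) _ mh h0))).
apply: eq_integral => x _; rewrite /fubini_F/=.
rewrite (ge0_integral_shift (t * x) (fun y => h (x, y)))//.
by apply: measurableT_comp => //; measurable_arith.
Qed.

Lemma ge0_integral_rotation c s h : c ^+ 2 + s ^+ 2 = 1 ->
  measurable_fun [set: R * R] h -> (forall z, 0 <= h z)%E ->
  (\int[mu \x mu]_z h (c * z.1 - s * z.2, s * z.1 + c * z.2)%R =
   \int[mu \x mu]_z h z)%E.
Proof.
have rot c' s' k : s' != 0 -> c' ^+ 2 + s' ^+ 2 = 1 ->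
    measurable_fun [set: R * R] k -> (forall z, 0 <= k z)%E ->
    (\int[mu \x mu]_z k (c' * z.1 - s' * z.2, s' * z.1 + c' * z.2)%R =
     \int[mu \x mu]_z k z)%E.
  (* a rotation of angle a is a product of three shears, by tan (a / 2), sin a, tan (a / 2) *)
  move=> s0 cs1 mk k0; pose t := (c' - 1) / s'.
  rewrite -(ge0_integral_shear1 t k)//.
  rewrite -[RHS](ge0_integral_shear2 s')//; last first.
    by apply: measurableT_comp => //; measurable_arith.
  rewrite -[RHS](ge0_integral_shear1 t)//; last first.
    by apply: (measurableT_comp mk) => /=; measurable_arith.
  (* These two identities collapse the product of the shears to the rotation matrix; the second one
     is [c' ^+ 2 - 1 = - s' ^+ 2] divided by [s']. *)
  have ts : t * s' = c' - 1 by rewrite /t divfK.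
  have tc : t * (1 + c') = - s'.
    by apply: (mulIf s0); rewrite mulrAC ts; lra.
  apply: eq_integral => -[x y] _ /=; congr (k (_, _)).
    have -> : x + t * y + t * (y + s' * (x + t * y)) =
        x * (1 + t * s') + y * (t + t * (1 + t * s')) by ring.
    have -> : 1 + t * s' = c' by rewrite ts; ring.
    have -> : t + t * c' = - s' by rewrite -tc; ring.
    by ring.
  have -> : y + s' * (x + t * y) = s' * x + (1 + t * s') * y by ring.
  by rewrite ts; ring.
move=> cs1 mh h0; have [s0|s0] := eqVneq s 0; last exact: rot.
(* the shears need sin a != 0; the angles 0 and pi are sums of two angles +- pi / 2 *)
have c0 : c != 0 by apply/eqP => c0; move: cs1; rewrite s0 c0; lra.
pose k z := h (0 * z.1 - c * z.2, c * z.1 + 0 * z.2)%R.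
have mk : measurable_fun [set: R * R] k.
  by apply: (measurableT_comp mh) => /=; measurable_arith.
have cE : 0 ^+ 2 + c ^+ 2 = 1 by move: cs1; rewrite s0; lra.
rewrite -[RHS](rot 0 c h c0 cE)// -[RHS](rot 0 (-1) k)//.
- by apply: eq_integral => -[x y] _ /=; rewrite s0 /k/=; congr (h (_, _)); ring.
- by ring.
- by move=> z; exact: h0.
Qed.

End planar_lebesgue.

(** * Measures given by a density *)

Definition density_measure {d} {T : measurableType d} {R : realType}
    (mu : set T -> \bar R) (f : T -> \bar R) (A : set T) : \bar R :=
  (\int[mu]_(x in A) f x)%E.

Section density_measure.
Context d (T : measurableType d) (R : realType) (mu : {measure set T -> \bar R}).
Variables (f : T -> \bar R) (mf : measurable_fun [set: T] f).
Hypothesis f0 : forall x, (0 <= f x)%E.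

Let density0 : density_measure mu f set0 = 0%E.
Proof. exact: integral_set0. Qed.

Let density_ge0 A : (0 <= density_measure mu f A)%E.
Proof. by apply: integral_ge0 => x _; exact: f0. Qed.

Let density_sigma_additive : semi_sigma_additive (density_measure mu f).
Proof.
move=> F mF tF mUF; rewrite /density_measure ge0_integral_bigcup//.
  by apply: is_cvg_ereal_nneg_natsum => n _; exact: density_ge0.
exact: measurable_funTS.
Qed.

HB.instance Definition _ := isMeasure.Build _ _ _ (density_measure mu f)
  density0 density_ge0 density_sigma_additive.
End density_measure.

(** * Planar Gaussian measures and their isotropy *)

Section gauss.
Context {R : realType}.
Local Notation mu := (@lebesgue_measure R).
Implicit Types (a b c s t : R) (h : R * R -> \bar R).

(* [normal_prob 0 s], as a measure on the Borel sets of [R] rather than on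
   [measurableTypeR R], whose display is different *)
Definition cnormal s : set R -> \bar R := normal_prob 0 s.

Let cnormal0 s : cnormal s set0 = 0%E.
Proof. exact: (measure0 (normal_prob 0 s)). Qed.

Let cnormal_ge0 s A : (0 <= cnormal s A)%E.
Proof. exact: (measure_ge0 (normal_prob 0 s)). Qed.

Let cnormal_sigma_additive s : semi_sigma_additive (cnormal s).
Proof. exact: (@measure_semi_sigma_additive _ _ _ (normal_prob 0 s)). Qed.

HB.instance Definition _ s := isMeasure.Build _ _ _ (cnormal s)
  (cnormal0 s) (cnormal_ge0 s) (@cnormal_sigma_additive s).

Let cnormal_setT s : cnormal s [set: R] = 1%E.
Proof. exact: (probability_setT (normal_prob 0 s)). Qed.

HB.instance Definition _ s :=
  Measure_isProbability.Build _ _ _ (cnormal s) (cnormal_setT s).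

(** For [s != 0], [s ^+ 2] is the variance of each coordinate, so that the squared modulus has mean
    [2 * s ^+ 2]; a standard complex Gaussian corresponds to [s = (Num.sqrt 2)^-1]. *)
Definition gauss s : set (R * R) -> \bar R := (cnormal s \x cnormal s)%E.

HB.instance Definition _ s := Probability.copy (gauss s)
  (cnormal s \x cnormal s)%E.

Definition gauss_pdf s (w : R * R) : \bar R :=
  (normal_pdf 0 s w.1 * normal_pdf 0 s w.2)%:E.

Lemma gauss_pdf_ge0 s w : (0 <= gauss_pdf s w)%E.
Proof. by rewrite lee_fin mulr_ge0 ?normal_pdf_ge0. Qed.

Lemma measurable_gauss_pdf s : measurable_fun [set: R * R] (gauss_pdf s).
Proof.
apply/measurable_EFinP; apply: measurable_funM.
  by apply: measurableT_comp; [exact: measurable_normal_pdf|exact: measurable_fst].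
by apply: measurableT_comp; [exact: measurable_normal_pdf|exact: measurable_snd].
Qed.

(** The two products differ only in the measurable structure named on [R]; pushing forward along the
    identity passes from one to the other. *)
Lemma gauss_normal_prob s (A : set (R * R)) : measurable A ->
  gauss s A = (normal_prob (0 : R) s \x normal_prob (0 : R) s)%E A.
Proof.
move=> mA; pose phi (x : measurableTypeR R) : R := x.
have mphi : measurable_fun setT phi by exact: measurable_id.
transitivity (\int[pushforward (normal_prob 0 s) phi]_x
    (cnormal s \o xsection A) x)%E.
  by apply: eq_measure_integral.
rewrite (ge0_integral_pushforward mphi)//.
exact: measurable_fun_xsection.
Qed.

(** By uniqueness of the product measure it suffices to treat rectangles, where Tonelli splits the
    integral of the product density. *)
Lemma gaussE s (A : set (R * R)) : measurable A ->
  gauss s A = (\int[(mu \x mu)%E]_(w in A) gauss_pdf s w)%E.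
Proof.
move=> mA; have mp := measurable_gauss_pdf s.
rewrite gauss_normal_prob//.
rewrite -[RHS]/(density_measure (mu \x mu)%E (gauss_pdf s) A).
apply: (product_measure_unique (m1 := normal_prob 0 s) (m2 := normal_prob 0 s)
  (m' := density_measure (mu \x mu)%E (gauss_pdf s))) => //.
  exact: gauss_pdf_ge0.
move=> ? B C mB mC; rewrite /= /density_measure integral_mkcond.
(* Cutting each density off outside its side of the rectangle makes the integrand a product of
   functions of one variable on the whole plane. *)
pose p (D : set R) := (fun x => (normal_pdf 0 s x)%:E) \_ D : R -> \bar R.
have p0 D x : (0 <= p D x)%E.
  by rewrite /p patchE; case: ifP => // _; rewrite lee_fin normal_pdf_ge0.
have mpD (D : set R) : measurable D -> measurable_fun [set: R] (p D).
  move=> mD; apply/(measurable_restrictT _ _).1 => //.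
  apply: measurable_funTS; apply/measurable_EFinP; exact: measurable_normal_pdf.
transitivity (\int[(mu \x mu)%E]_w (p B w.1 * p C w.2))%E.
  apply: eq_integral => -[x y] _; rewrite /p !patchE in_setX /gauss_pdf EFinM/=.
  by case: (x \in B) => //=; rewrite ?mul0e//; case: (y \in C); rewrite ?mule0.
rewrite (fubini_tonelli1 (m1 := mu) (m2 := mu))//=; last 2 first.
- apply: emeasurable_funM.
    by apply: measurableT_comp; [exact: mpD|exact: measurable_fst].
  by apply: measurableT_comp; [exact: mpD|exact: measurable_snd].
- by move=> x; rewrite mule_ge0.
rewrite /fubini_F/=.
transitivity (\int[mu]_x (p B x * \int[mu]_y p C y))%E.
  apply: eq_integral => x _; rewrite ge0_integralZl//; exact: mpD.
rewrite ge0_integralZr//; last 2 first.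
- exact: mpD.
- by apply: integral_ge0.
by rewrite /p -!integral_mkcond.
Qed.

Lemma gauss_pdf_rotation s a b (z : R * R) : s != 0 -> a ^+ 2 + b ^+ 2 = 1 ->
  gauss_pdf s (a * z.1 - b * z.2, b * z.1 + a * z.2) = gauss_pdf s z.
Proof.
move=> s0 ab1; rewrite /gauss_pdf !normal_pdfE//= /normal_fun.
rewrite [in LHS]mulrACA [in RHS]mulrACA -!expRD !subr0 -!mulrDl -!opprD.
congr EFin; congr (_ * _); congr expR; congr (_ / _); congr (- _).
transitivity ((a ^+ 2 + b ^+ 2) * (z.1 ^+ 2 + z.2 ^+ 2)); first by ring.
by rewrite ab1 mul1r.
Qed.

Lemma measurable_rotation a b : measurable_fun [set: R * R]
  (fun z : R * R => (a * z.1 - b * z.2, b * z.1 + a * z.2)).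
Proof. by measurable_arith. Qed.

(** Both ingredients are rotation invariant: the density, a function of the modulus, and planar
    Lebesgue measure. *)
Lemma gauss_rotation s a b (A : set (R * R)) :
  s != 0 -> a ^+ 2 + b ^+ 2 = 1 -> measurable A ->
  gauss s ((fun z => (a * z.1 - b * z.2, b * z.1 + a * z.2)) @^-1` A) =
  gauss s A.
Proof.
move=> s0 ab1 mA; set rho := (fun z => _).
have mrho : measurable_fun [set: R * R] rho by exact: measurable_rotation.
have mrA : measurable (rho @^-1` A) by rewrite -[X in measurable X]setTI; exact: mrho.
rewrite !gaussE// [LHS]integral_mkcond [RHS]integral_mkcond.
have mp : measurable_fun [set: R * R] (gauss_pdf s \_ A).
  apply/(measurable_restrictT _ _).1 => //.
  by apply: measurable_funTS; exact: measurable_gauss_pdf.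
have p0 z : (0 <= (gauss_pdf s \_ A) z)%E.
  by rewrite patchE; case: ifP => // _; exact: gauss_pdf_ge0.
apply: (etrans _ (ge0_integral_rotation a b _ ab1 mp p0)).
apply: eq_integral => z _; rewrite !patchE gauss_pdf_rotation//.
Qed.

Lemma ge0_integral_gauss_rotation s a b h : s != 0 -> a ^+ 2 + b ^+ 2 = 1 ->
  measurable_fun [set: R * R] h -> (forall z, 0 <= h z)%E ->
  (\int[gauss s]_z h (a * z.1 - b * z.2, b * z.1 + a * z.2)%R =
   \int[gauss s]_z h z)%E.
Proof.
move=> s0 ab1 mh h0.
have mrho := measurable_rotation a b.
transitivity (\int[pushforward (gauss s)
    (fun z : R * R => (a * z.1 - b * z.2, b * z.1 + a * z.2)%R)]_z h z)%E.
  exact: (esym (ge0_integral_pushforward mrho _ measurableT mh (fun y _ => h0 y))).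
apply: eq_measure_integral => A mA _; exact: gauss_rotation.
Qed.

(** Multiplication by the complex number [a + i b] is the rotation by [(a + i b) / r] followed by
    the dilation by [r], and the rotation preserves the Gaussian. For [r = 0] both maps vanish. *)
Lemma ge0_integral_gauss_cmul s a b r h : s != 0 -> r ^+ 2 = a ^+ 2 + b ^+ 2 ->
  measurable_fun [set: R * R] h -> (forall z, 0 <= h z)%E ->
  (\int[gauss s]_z h (a * z.1 - b * z.2, b * z.1 + a * z.2)%R =
   \int[gauss s]_z h (r * z.1, r * z.2)%R)%E.
Proof.
move=> s0 rab mh h0; have [r0|r0] := eqVneq r 0.
  have [-> ->] : a = 0 /\ b = 0.
    move: rab; rewrite r0 expr0n/= => /esym/eqP.
    by rewrite paddr_eq0 ?sqr_ge0// !sqrf_eq0 => /andP[/eqP -> /eqP ->].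
  by apply: eq_integral => z _; rewrite r0 !mul0r subr0 addr0.
rewrite -[RHS](ge0_integral_gauss_rotation s (a / r) (b / r))//.
- by apply: eq_integral => z _; congr (h (_, _)) => /=; field.
- by rewrite !expr_div_n -mulrDl -rab divff// sqrf_eq0.
- by apply: (measurableT_comp mh) => /=; measurable_arith.
Qed.

(** Stability of centered Gaussians under sums, without convolution: [a * x + b * y] is the real
    part of [(a - i b) (x + i y)], so isotropy turns it into [r * x]. *)
Lemma ge0_integral_normal_add s a b r (f : R -> \bar R) : s != 0 ->
  r ^+ 2 = a ^+ 2 + b ^+ 2 ->
  measurable_fun [set: R] f -> (forall x, 0 <= f x)%E ->
  (\int[cnormal s]_x \int[cnormal s]_y f (a * x + b * y)%R =
   \int[cnormal s]_x f (r * x)%R)%E.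
Proof.
move=> s0 rab mf f0.
have mfst c d : measurable_fun [set: R * R] (fun z => f (c * z.1 + d * z.2)%R).
  by apply: (measurableT_comp mf) => /=; measurable_arith.
transitivity (\int[gauss s]_z f (a * z.1 + b * z.2)%R)%E.
  by rewrite (fubini_tonelli1 (m1 := cnormal s) (m2 := cnormal s)).
transitivity (\int[gauss s]_z f (r * z.1)%R)%E.
  rewrite -(ge0_integral_gauss_cmul s a (- b) r (fun z => f z.1))//.
  - by apply: eq_integral => z _; congr f => /=; ring.
  - by rewrite sqrrN.
  - by apply: (measurableT_comp mf); exact: measurable_fst.
rewrite (fubini_tonelli1 (m1 := cnormal s) (m2 := cnormal s))//.
- apply: eq_integral => x _; rewrite /fubini_F/= integral_cst//.
  by rewrite [X in (_ * X)%E](probability_setT (cnormal s)) mule1.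
- by apply: (measurableT_comp mf) => /=; measurable_arith.
Qed.

End gauss.

(** * Linear combinations and dilations of planar Gaussians *)

Section gauss_add.
Context {R : realType}.
Implicit Types (a b c s t r : R) (h : R * R -> \bar R).

Lemma gauss_integralE s h :
  measurable_fun [set: R * R] h -> (forall z, 0 <= h z)%E ->
  (\int[gauss s]_z h z = \int[cnormal s]_x \int[cnormal s]_y h (x, y))%E.
Proof. by move=> mh h0; rewrite (fubini_tonelli1 (m1 := cnormal s) (m2 := cnormal s)). Qed.

Lemma measurable_integral2 d (T : measurableType d) d' (S : measurableType d')
  (m : {sigma_finite_measure set S -> \bar R}) (g : T -> S -> \bar R) :
  measurable_fun [set: T * S] (fun z => g z.1 z.2) -> (forall x y, 0 <= g x y)%E ->
  measurable_fun [set: T] (fun x => \int[m]_y g x y)%E.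
Proof.
move=> mg g0.
exact: (@measurable_fun_fubini_tonelli_F _ _ _ _ _ m (fun z => g z.1 z.2)).
Qed.

(** The real and imaginary parts are independent, so the one-dimensional addition rule is applied to
    each in turn. *)
Lemma ge0_integral_gauss_add s a b r h : s != 0 -> r ^+ 2 = a ^+ 2 + b ^+ 2 ->
  measurable_fun [set: R * R] h -> (forall z, 0 <= h z)%E ->
  (\int[gauss s]_z \int[gauss s]_w
     h (a * z.1 + b * w.1, a * z.2 + b * w.2)%R =
   \int[gauss s]_z h (r * z.1, r * z.2)%R)%E.
Proof.
move=> s0 rab mh h0.
rewrite gauss_integralE//; last 2 first.
- apply: measurable_integral2 => //; apply: (measurableT_comp mh); measurable_arith.
- by move=> z; apply: integral_ge0.
transitivity (\int[cnormal s]_x \int[cnormal s]_y \int[cnormal s]_v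
   h (a * x + b * y, r * v)%R)%E.
  apply: eq_integral => x1 _.
  transitivity (\int[cnormal s]_x2 \int[cnormal s]_y1 \int[cnormal s]_y2
     h (a * x1 + b * y1, a * x2 + b * y2)%R)%E.
    apply: eq_integral => x2 _; rewrite gauss_integralE//.
    by apply: (measurableT_comp mh) => /=; measurable_arith.
  (* Exchanging the two middle integrals places the two imaginary parts next to each other. *)
  rewrite (fubini_tonelli (m1 := cnormal s) (m2 := cnormal s)
    (fun p => \int[cnormal s]_y2 h (a * x1 + b * p.2, a * p.1 + b * y2)%R))%E/=.
  - apply: eq_integral => y1 _.
    rewrite (@ge0_integral_normal_add _ s a b r (fun v => h (a * x1 + b * y1, v)%R))//.
    by apply: (measurableT_comp mh) => /=; measurable_arith.
  - by apply: measurable_integral2 => //; apply: (measurableT_comp mh); measurable_arith.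
  - by move=> z; apply: integral_ge0.
rewrite (@ge0_integral_normal_add _ s a b r
  (fun u => \int[cnormal s]_v h (u, r * v)%R)%E)//.
- by rewrite gauss_integralE//; apply: (measurableT_comp mh) => /=; measurable_arith.
- by apply: measurable_integral2 => //; apply: (measurableT_comp mh); measurable_arith.
- by move=> u; apply: integral_ge0.
Qed.

(* [a z + (b1 + i b2) w] for independent [z], [w] *)
Lemma ge0_integral_gauss_lin s a b1 b2 r h : s != 0 ->
  r ^+ 2 = a ^+ 2 + (b1 ^+ 2 + b2 ^+ 2) ->
  measurable_fun [set: R * R] h -> (forall z, 0 <= h z)%E ->
  (\int[gauss s]_z \int[gauss s]_w
     h (a * z.1 + (b1 * w.1 - b2 * w.2), a * z.2 + (b2 * w.1 + b1 * w.2))%R =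
   \int[gauss s]_z h (r * z.1, r * z.2)%R)%E.
Proof.
move=> s0 rab mh h0; pose b := Num.sqrt (b1 ^+ 2 + b2 ^+ 2).
have b12 : b ^+ 2 = b1 ^+ 2 + b2 ^+ 2 by rewrite sqr_sqrtr// addr_ge0 ?sqr_ge0.
have rab' : r ^+ 2 = a ^+ 2 + b ^+ 2 by rewrite b12.
apply: (etrans _ (ge0_integral_gauss_add s a b r h s0 rab' mh h0)).
apply: eq_integral => z _.
rewrite (ge0_integral_gauss_cmul s b1 b2 b
  (fun w => h (a * z.1 + w.1, a * z.2 + w.2)%R))//.
by apply: (measurableT_comp mh) => /=; measurable_arith.
Qed.

(** The Jacobian [s] of the dilation cancels the factor [s^-1] in the peak of the normal density. *)
Lemma cnormal_scale s (A : set R) : 0 < s -> measurable A ->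
  cnormal s A = cnormal 1 ((fun x => s * x) @^-1` A).
Proof.
move=> s0 mA; rewrite /cnormal /normal_prob.
have ms : measurable_fun [set: R] (fun x : R => s * x) by measurable_arith.
rewrite [LHS]integral_mkcond [RHS]integral_mkcond.
set f := (fun x => (normal_pdf 0 s x)%:E) \_ A.
have mf : measurable_fun [set: R] f.
  apply/(measurable_restrictT _ _).1 => //.
  by apply: measurable_funTS; apply/measurable_EFinP; exact: measurable_normal_pdf.
have f0 x : (0 <= f x)%E.
  by rewrite /f patchE; case: ifP => // _; rewrite lee_fin normal_pdf_ge0.
rewrite (ge0_integral_affine s 0 f s0 mf f0) -ge0_integralZl//=; last 2 first.
- by apply: (measurableT_comp mf); measurable_arith.
- by rewrite lee_fin ltW.
apply: eq_integral => x _; rewrite /f !patchE addr0.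
rewrite (_ : (x \in _) = (s * x \in A)); last by apply/idP/idP; rewrite !inE.
case: ifP => _; last by rewrite mule0.
rewrite -EFinM !normal_pdfE ?gt_eqF ?oner_eq0//; congr EFin.
rewrite mulrA; congr (_ * expR _); last by field; rewrite gt_eqF.
rewrite /normal_peak -mulrnAr sqrtrM ?sqr_ge0// sqrtr_sqr gtr0_norm// invfM mulrA.
by rewrite divff ?gt_eqF// mul1r expr1n mul1r.
Qed.

Lemma gauss_scale s (A : set (R * R)) : 0 < s -> measurable A ->
  gauss s A = gauss 1 ((fun z => (s * z.1, s * z.2)) @^-1` A).
Proof.
move=> s0 mA; pose phi (z : R * R) := (s * z.1, s * z.2).
have mphi : measurable_fun [set: R * R] phi by rewrite /phi; measurable_arith.
apply: (product_measure_unique (m1 := cnormal s) (m2 := cnormal s)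
  (m' := pushforward (gauss 1) phi)) => // B C mB mC.
have ms : measurable_fun [set: R] (fun x : R => s * x) by measurable_arith.
have mpre (D : set R) : measurable D -> measurable ((fun x : R => s * x) @^-1` D).
  by move=> mD; rewrite -[X in measurable X]setTI; exact: ms.
have := product_measure1E (cnormal 1) (cnormal 1) (mpre _ mB) (mpre _ mC).
move=> e; apply: (etrans e).
exact: (esym (congr2 mule (cnormal_scale s B s0 mB) (cnormal_scale s C s0 mC))).
Qed.

(** With [N = n.+1], the density [N / pi * exp (- N |w|^2)] splits into two centered normal
    densities of variance [1 / (2 N)]. *)
Lemma ginibre_gauss n (A : set (R * R)) : measurable A ->
  (\int[(@lebesgue_measure R \x @lebesgue_measure R)%E]_(w in A)
     (ginibre_pdf n.+1 w)%:E)%E = gauss (Num.sqrt (n.+1%:R *+ 2)^-1) A.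
Proof.
move=> mA; rewrite gaussE//; apply: eq_integral => -[x y] _; congr EFin.
set s := Num.sqrt _.
have s2 : s ^+ 2 = (n.+1%:R *+ 2)^-1 by rewrite sqr_sqrtr// invr_ge0 mulrn_wge0.
have s0 : s != 0.
  by rewrite gt_eqF// sqrtr_gt0 invr_gt0 pmulrn_lgt0.
rewrite /ginibre_pdf; move: s2; have : (n.+1%:R : R) != 0 by rewrite pnatr_eq0.
move: n.+1%:R => N N0 s2; rewrite !normal_pdfE//= /normal_fun mulrACA -expRD !subr0.
congr (_ * expR _).
  rewrite /normal_peak -expr2 exprVn sqr_sqrtr; last first.
    by rewrite mulrn_wge0// mulr_ge0 ?sqr_ge0// pi_ge0.
  rewrite s2; have := pi_gt0 R; move: (@pi R) => p p0.
  by field; rewrite N0 gt_eqF.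
by rewrite sqr_sqrtr ?addr_ge0 ?sqr_ge0// s2; field; rewrite N0.
Qed.

End gauss_add.

(** * Integrating out an independent variable *)

Section freezing.
Context d (Omega : measurableType d) (R : realType) (P : probability Omega R).

(** Independence identifies the joint law of [(V, W)] with a product measure, as the two agree on
    rectangles; Tonelli then integrates [W] out. *)
Lemma ge0_integral_independent d1 (E : measurableType d1) d2
    (S : measurableType d2) (V : Omega -> E) (W : Omega -> S)
    (nu : probability S R) (g : E -> S -> \bar R) :
  measurable_fun [set: Omega] V -> measurable_fun [set: Omega] W ->
  (forall B A, measurable B -> measurable A ->
     P (V @^-1` B `&` W @^-1` A) = (P (V @^-1` B) * nu A)%E) ->
  measurable_fun [set: E * S] (fun z => g z.1 z.2) ->
  (forall x y, 0 <= g x y)%E ->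
  (\int[P]_w g (V w) (W w) = \int[P]_w \int[nu]_y g (V w) y)%E.
Proof.
move=> mV mW VW mg g0.
pose mVW : {mfun Omega >-> (E * S)%type} :=
  mfun_Sub (mem_set (measurable_fun_pair mV mW)).
pose mV' : {mfun Omega >-> E} := mfun_Sub (mem_set mV).
transitivity (\int[distribution P mVW]_z g z.1 z.2)%E.
  by rewrite ge0_integral_distribution.
transitivity (\int[(distribution P mV' \x nu)%E]_z g z.1 z.2)%E.
  apply: eq_measure_integral => A mA _; apply/esym.
  by apply: product_measure_unique => // B C mB mC; exact: VW.
rewrite (fubini_tonelli1 (m1 := distribution P mV') (m2 := nu))//.
rewrite (ge0_integral_distribution mV')//.
- exact: measurable_integral2.
- by move=> x; apply: integral_ge0.
Qed.

End freezing.

(** * Sigma-algebras generated by subfamilies of an independent family *)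

Section independence.
Context d (Omega : measurableType d) (R : realType) (P : probability Omega R).
Context d' (S : measurableType d') (I : finType) (D : pred I) (X : I -> Omega -> S).

(** A pi-system generating the sigma-algebra of the [X i] with [i] in [J]. Working on [Omega] itself
    expresses dependence on these variables alone as measurability. *)
Definition cylinders (J : {set I}) : set (set Omega) :=
  [set \bigcap_(i in [set i | i \in J]) X i @^-1` A i |
     A in [set A : I -> set S | forall i, measurable (A i)]].

Lemma measurable_cylinders_subset d1 (E : measurableType d1) (J K : {set I})
    (f : Omega -> E) : J \subset K ->
  measurable_fun [set: g_sigma_algebraType (cylinders J)] f ->
  measurable_fun [set: g_sigma_algebraType (cylinders K)] f.
Proof.
move=> JK mf _ A mA; have := mf measurableT A mA; apply: sub_sigma_algebra2.
(* Indices outside [J] receive the full set, hence no constraint. *)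
move=> _ [B mB <-]; exists (fun i => if i \in J then B i else setT).
  by move=> i; case: ifP.
apply/seteqP; split => w H i /= iJ.
  by have := H i (fintype.subsetP JK _ iJ); rewrite /= iJ.
by case: ifPn => // iJ'; exact: H.
Qed.

Lemma measurable_cylinders_in (J : {set I}) i : i \in J ->
  measurable_fun [set: g_sigma_algebraType (cylinders J)] (X i).
Proof.
move=> iJ _ A mA; rewrite setTI; apply: sub_sigma_algebra.
exists (fun j => if j == i then A else setT).
  by move=> j; case: ifP.
apply/seteqP; split => w.
  by move=> /(_ i iJ); rewrite /= eqxx.
by move=> H j _ /=; case: eqP => // ->.
Qed.

Hypothesis mX : forall i, D i -> measurable_fun [set: Omega] (X i).
Hypothesis indX : mutually_independent P D X.

Lemma cylinders_measurable (J : {set I}) : (forall i, i \in J -> D i) ->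
  cylinders J `<=` measurable.
Proof.
move=> JD _ [A mA <-]; apply: fin_bigcap_measurable => // i /= iJ.
by rewrite -[X in measurable X]setTI; exact: mX (JD _ iJ) measurableT _ (mA i).
Qed.

Lemma measurable_id_cylinders (J : {set I}) : (forall i, i \in J -> D i) ->
  measurable_fun [set: Omega] (id : Omega -> g_sigma_algebraType (cylinders J)).
Proof.
move=> JD _ A mA; rewrite setTI preimage_id.
exact: (smallest_sub (@sigma_algebra_measurable _ Omega) (cylinders_measurable J JD)).
Qed.

(** For fixed [A], both sides are finite measures in [B] that agree on a pi-system: a cylinder over
    [J] intersected with an event on [X i] is a cylinder over [i |: J], to which mutual independence
    applies. *)
Lemma cylinders_independent (J : {set I}) i (nu : probability S R) :
  (forall i, i \in J -> D i) -> D i -> i \notin J ->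
  (forall A, measurable A -> P (X i @^-1` A) = nu A) ->
  forall B A, <<s cylinders J >> B -> measurable A ->
    P (B `&` X i @^-1` A) = (P B * nu A)%E.
Proof.
move=> JD Di iJ nuE B A mB mA.
have mXA : measurable (X i @^-1` A).
  by rewrite -[X in measurable X]setTI; exact: mX.
have nuA : (nu A \is a fin_num) by rewrite fin_num_measure.
have c0 : 0 <= fine (nu A) by rewrite fine_ge0.
have -> : (P B * nu A = mscale (NngNum c0) P B)%E.
  by rewrite /mscale/= fineK// muleC.
apply: (@g_sigma_algebra_measure_unique _ R Omega (cylinders J)
  (cylinders_measurable J JD) (fun=> setT) _ _ (mrestr P mXA) (mscale (NngNum c0) P)) => //.
- by move=> _; exists (fun=> setT) => //; apply/seteqP; split.
- by rewrite bigcup_const//; exists 0%N.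
- move=> _ _ [C mC <-] [C' mC' <-]; exists (fun j => C j `&` C' j).
    by move=> j; exact: measurableI.
  apply/seteqP; split => [w H|w [H H'] j jJ]; last by split; [exact: H|exact: H'].
  by split => j jJ; have [] := H j jJ.
- move=> _ [C mC <-]; rewrite -[LHS]/(P (_ `&` _)) -[RHS]/((fine (nu A))%:E * P _)%E fineK//.
  pose C' j := if j == i then A else C j.
  have mC' j : measurable (C' j) by rewrite /C'; case: ifP.
  have C'J j : j \in J -> C' j = C j.
    by move=> jJ; rewrite /C' ifN//; apply: contraNneq iJ => <-.
  transitivity (P (\bigcap_(j in [set j | j \in (i |: J)%SET]) X j @^-1` C' j)).
    congr (P _); apply/seteqP; split => w.
      move=> [H XA] j /=; rewrite in_setU1 => /orP[/eqP ->|jJ].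
        by rewrite /C' eqxx.
      by rewrite C'J//; exact: H.
    move=> H; split.
      by move=> j jJ; have := H j; rewrite /= in_setU1 jJ orbT C'J//; exact.
    by have := H i; rewrite /= setU11 /C' eqxx; exact.
  rewrite indX//; last by move=> j; rewrite in_setU1 => /orP[/eqP ->//|/JD].
  rewrite big_setU1//= {1}/C' eqxx nuE// indX//.
  by congr (_ * _)%E; apply: eq_bigr => j jJ; rewrite C'J.
- by move=> _; rewrite -[ltLHS]/(P (_ `&` _)) ltey_eq fin_num_measure//; exact: measurableI.
Qed.

(** Freezing with [V] the identity map from [Omega] to [Omega] with the coarser sigma-algebra, so
    that [g] may involve any function of [omega] determined by the family over [J]. *)
Lemma ge0_integral_cylinders (J : {set I}) i (nu : probability S R)
    (g : Omega -> S -> \bar R) :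
  (forall i, i \in J -> D i) -> D i -> i \notin J ->
  (forall A, measurable A -> P (X i @^-1` A) = nu A) ->
  measurable_fun [set: g_sigma_algebraType (cylinders J) * S]
    (fun z => g z.1 z.2) ->
  (forall x y, 0 <= g x y)%E ->
  (\int[P]_w g w (X i w) = \int[P]_w \int[nu]_y g w y)%E.
Proof.
move=> JD Di iJ nuE mg g0.
apply: (@ge0_integral_independent _ Omega R P _
  (g_sigma_algebraType (cylinders J)) _ S id (X i) nu g) => //.
- exact: measurable_id_cylinders.
- exact: mX.
- by move=> B A mB mA; rewrite preimage_id; exact: cylinders_independent mB mA.
Qed.
End independence.

Arguments cylinders {d Omega d' S I} X J.
Arguments measurable_cylinders_in {d Omega d' S I} X {J i}.
Arguments measurable_cylinders_subset {d Omega d' S I} X {d1 E J K f}.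

(** * Eigenvectors of a triangular matrix and the recursion for the overlap *)

Section overlap.
Context {R : realType} (n : nat) (lam : 'I_n.+1 -> R[i]).
Hypothesis lam_inj : injective lam.
Variables (M : 'M[R[i]]_n.+1) (r l : 'I_n.+1 -> 'cV[R[i]]_n.+1).
Hypothesis Mdiag : forall i, M i i = lam i.
Hypothesis Mtriang : forall i j : 'I_n.+1, (j < i)%N -> M i j = 0.
Hypothesis Mrl : biorthogonal_eigenvectors M lam r l.

(** Back substitution: once the coordinates after [k] vanish, row [k] of the eigenvector equation
    reads [lam k * r_k = lam ord0 * r_k], with distinct eigenvalues. *)
Lemma right_eigenvector0 k : k != ord0 -> r ord0 k 0 = 0.
Proof.
(* Induction on [n - k], which treats the last coordinate first. *)
have [m] := ubnP (n - k); elim: m k => // m IH k; rewrite ltnS => nkm k0.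
have [/(_ ord0) /matrixP /(_ k 0) + _ _] := Mrl.
rewrite !mxE (bigD1 k)//= big1 ?addr0; last first.
  move=> j jk; have [jltk|kltj|/val_inj/eqP] := ltngtP j k.
  - by rewrite Mtriang// mul0r.
  - rewrite IH ?mulr0//.
      by apply: leq_trans nkm; rewrite ltn_sub2l// (leq_trans kltj)// -ltnS.
    by rewrite -val_eqE/= -lt0n (leq_trans _ kltj).
  - by rewrite (negbTE jk).
rewrite Mdiag => /eqP; rewrite -subr_eq0 -mulrBl mulf_eq0 subr_eq0 => /orP[|/eqP//].
by move=> /eqP/lam_inj kE; rewrite kE eqxx in k0.
Qed.

(** The [b_k] of the argument above: as the first coordinates of the two eigenvectors multiply to 1,
    this is [l_k / l_0], written without a division. *)
Definition left_ratio k : R[i] := l ord0 k 0 * r ord0 ord0 0.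

Lemma left_ratio0 : left_ratio ord0 = 1.
Proof.
have [_ _ /(_ ord0 ord0) /matrixP /(_ 0 0)] := Mrl.
rewrite !mxE eqxx mulr1n (bigD1 ord0)//= big1 ?addr0 ?mxE//.
by move=> k k0; rewrite right_eigenvector0// mulr0.
Qed.

(** Column [k] of the left eigenvector equation: triangularity removes the rows below [k], and the
    diagonal term moves to the other side. *)
Lemma left_ratio_rec k : k != ord0 ->
  left_ratio k = (lam ord0 - lam k)^-1 *
                 \sum_(i < n.+1 | (i < k)%N) left_ratio i * M i k.
Proof.
move=> k0; have lk : lam ord0 - lam k != 0.
  by rewrite subr_eq0; apply: contraNneq k0 => /lam_inj ->.
apply: (mulfI lk); rewrite mulVKf//.
have [_ /(_ ord0) /matrixP /(_ 0 k) + _] := Mrl.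
rewrite !mxE (bigID (fun i : 'I_n.+1 => (i < k)%N))/=.
rewrite [X in _ + X](bigD1 k)/= ?ltnn// [X in _ + (_ + X)]big1 ?addr0; last first.
  move=> i /andP[]; rewrite -leqNgt leq_eqVlt => /orP[/eqP/val_inj->|ki _].
    by rewrite eqxx.
  by rewrite Mtriang// mulr0.
rewrite !mxE Mdiag => /(congr1 (fun x => x * r ord0 ord0 0)).
under eq_bigr do rewrite mxE.
rewrite mulrDl mulr_suml => e.
rewrite mulrBl /left_ratio; under eq_bigr do rewrite mulrAC.
apply/eqP; rewrite subr_eq mulrA -e; apply/eqP; congr (_ + _); ring.
Qed.

(** The right eigenvector has a single nonzero coordinate, whose squared modulus is absorbed into
    each term of the norm of the left one. *)
Lemma overlap_left_ratio :
  diagonal_overlap r l ord0 = \sum_(k < n.+1) Normc.normc (left_ratio k) ^+ 2.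
Proof.
rewrite /diagonal_overlap {1}/sqnorm (bigD1 ord0)//= big1 ?addr0; last first.
  by move=> k k0; rewrite right_eigenvector0// Normc.normc0 expr0n.
rewrite mulr_sumr; apply: eq_bigr => k _.
by rewrite /left_ratio Normc.normcM exprMn mulrC.
Qed.

End overlap.

(** * Measurability of complex-valued maps through their coordinates *)

Section complex_measurable.
Context {R : realType}.
Implicit Types x y z : R[i].

Lemma sqr_normc_reim x : Normc.normc x ^+ 2 = (reim x).1 ^+ 2 + (reim x).2 ^+ 2.
Proof. by case: x => a b /=; rewrite sqr_sqrtr// addr_ge0 ?sqr_ge0. Qed.

Lemma reimD x y : reim (x + y) = ((reim x).1 + (reim y).1, (reim x).2 + (reim y).2).
Proof. by case: x; case: y. Qed.

(** The second coordinate is ordered to match the shape of the planar maps in the Gaussian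
    lemmas. *)
Lemma reimM x y : reim (x * y) =
  ((reim x).1 * (reim y).1 - (reim x).2 * (reim y).2,
   (reim x).2 * (reim y).1 + (reim x).1 * (reim y).2).
Proof. by case: x => a b; case: y => c e; congr (_, _); rewrite /= addrC. Qed.

Context d (T : measurableType d).
Implicit Types f g : T -> R[i].

Lemma measurable_reim_cst x : measurable_fun [set: T] (fun=> reim x).
Proof. exact: measurable_cst. Qed.

Lemma measurable_reimD f g :
  measurable_fun [set: T] (fun w => reim (f w)) ->
  measurable_fun [set: T] (fun w => reim (g w)) ->
  measurable_fun [set: T] (fun w => reim (f w + g w)).
Proof.
move=> mf mg; rewrite (funext (fun w => reimD (f w) (g w))).
by measurable_arith; assumption.
Qed.

Lemma measurable_reimM f g :
  measurable_fun [set: T] (fun w => reim (f w)) ->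
  measurable_fun [set: T] (fun w => reim (g w)) ->
  measurable_fun [set: T] (fun w => reim (f w * g w)).
Proof.
move=> mf mg; rewrite (funext (fun w => reimM (f w) (g w))).
by measurable_arith; assumption.
Qed.

Lemma measurable_reim_sum (I : Type) (s : seq I) (p : pred I) (F : I -> T -> R[i]) :
  (forall i, p i -> measurable_fun [set: T] (fun w => reim (F i w))) ->
  measurable_fun [set: T] (fun w => reim (\sum_(i <- s | p i) F i w)).
Proof.
move=> mF; elim: s => [|i s IH].
  rewrite [X in measurable_fun _ X](_ : _ = cst (reim 0)); first exact: measurable_cst.
  by apply/funext => w; rewrite big_nil.
have [pi|npi] := boolP (p i); last first.
  rewrite [X in measurable_fun _ X](_ : _ = (fun w => reim (\sum_(j <- s | p j) F j w)))//.
  by apply/funext => w; rewrite big_cons (negbTE npi).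
rewrite [X in measurable_fun _ X](_ : _ =
  (fun w => reim (F i w + \sum_(j <- s | p j) F j w))).
  by apply: measurable_reimD => //; exact: mF.
by apply/funext => w; rewrite big_cons pi.
Qed.

Lemma measurable_sqr_normc f :
  measurable_fun [set: T] (fun w => reim (f w)) ->
  measurable_fun [set: T] (fun w => Normc.normc (f w) ^+ 2).
Proof.
move=> mf; rewrite (funext (fun w => sqr_normc_reim (f w))).
by measurable_arith; assumption.
Qed.

End complex_measurable.

(** * The law of a standard complex Gaussian *)

Section gaussian_law.
Context {R : realType}.

Lemma ge0_integral_gauss_scale (s : R) (h : R * R -> \bar R) : 0 < s ->
  measurable_fun [set: R * R] h -> (forall z, 0 <= h z)%E ->
  (\int[gauss s]_z h z = \int[gauss 1]_z h (s * z.1, s * z.2)%R)%E.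
Proof.
move=> s0 mh h0.
have ms : measurable_fun [set: R * R] (fun z : R * R => (s * z.1, s * z.2)) by measurable_arith.
transitivity (\int[pushforward (gauss 1)
    (fun z : R * R => (s * z.1, s * z.2)%R)]_z h z)%E.
  by apply: eq_measure_integral => A mA _; exact: gauss_scale.
exact: (ge0_integral_pushforward ms _ measurableT mh (fun y _ => h0 y)).
Qed.

Lemma standard_complex_gaussianE d (Omega : measurableType d) (P : probability Omega R)
    (Z : Omega -> R[i]) : standard_complex_gaussian P Z ->
  measurable_fun [set: Omega] (fun w => reim (Z w)) /\
  forall A, measurable A ->
    P ((fun w => reim (Z w)) @^-1` A) = gauss (Num.sqrt 2)^-1 A.
Proof.
move=> [N1 [N2 [N1E N2E N12 ZE]]].
set s := (Num.sqrt 2)^-1 in ZE *.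
have s0 : 0 < s by rewrite invr_gt0 sqrtr_gt0.
have ZE' w : reim (Z w) = (s * N1 w, s * N2 w).
  by rewrite ZE /reim/=; congr (_, _); ring.
have mN : measurable_fun [set: Omega] (fun w => (N1 w : R, N2 w : R)).
  exact: measurable_fun_pair.
have ms : measurable_fun [set: R * R] (fun z : R * R => (s * z.1, s * z.2)) by measurable_arith.
have mpre A : measurable A -> measurable ((fun z : R * R => (s * z.1, s * z.2)) @^-1` A).
  by move=> mA; rewrite -[X in measurable X]setTI; exact: ms.
split=> [|A mA]; first by rewrite (funext ZE'); exact: (measurableT_comp ms mN).
rewrite gauss_scale//.
transitivity (P ((fun w => (N1 w : R, N2 w : R)) @^-1`
    ((fun z : R * R => (s * z.1, s * z.2)) @^-1` A))).
  by congr (P _); apply/funext => w; rewrite /preimage/= ZE'.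
apply/esym; apply: (product_measure_unique (m1 := cnormal 1) (m2 := cnormal 1)
  (m' := pushforward P (fun w => (N1 w : R, N2 w : R)))) => //; last exact: mpre.
move=> B C mB mC; rewrite -[LHS]/(P (N1 @^-1` B `&` N2 @^-1` C)) N12//.
by congr (_ * _)%E; [exact: N1E|exact: N2E].
Qed.

End gaussian_law.

(** * One step of the recursion along the columns of the Schur form *)

Section schur_recursion.
Context d (Omega : measurableType d) (R : realType) (P : probability Omega R).
Variables (n : nat) (s : R) (lambda : 'I_n.+1 -> R[i]).
Variables (T : Omega -> 'M[R[i]]_n.+1) (b : 'I_n.+1 -> Omega -> R[i]).
Hypothesis s0 : s != 0.
Let X (ij : 'I_n.+1 * 'I_n.+1) w := reim (T w ij.1 ij.2).
Hypothesis mX : forall ij : 'I_n.+1 * 'I_n.+1, (ij.1 < ij.2)%N ->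
  measurable_fun [set: Omega] (X ij).
Hypothesis lawX : forall ij : 'I_n.+1 * 'I_n.+1, (ij.1 < ij.2)%N ->
  forall A, measurable A -> P (X ij @^-1` A) = gauss s A.
Hypothesis indX : mutually_independent P
  (fun ij : 'I_n.+1 * 'I_n.+1 => (ij.1 < ij.2)%N) X.
Hypothesis b0 : forall w, b ord0 w = 1.
Hypothesis b_rec : forall w k, k != ord0 ->
  b k w = (lambda k)^-1 * \sum_(i < n.+1 | (i < k)%N) b i w * T w i k.

(** The entries above the diagonal are read column by column, downwards; these are the ones read
    once the columns before [k] and the top [m] places of column [k] are known. *)
Definition entries (k m : nat) : {set 'I_n.+1 * 'I_n.+1} :=
  [set ij : 'I_n.+1 * 'I_n.+1 | (ij.1 < ij.2)%N &&
    ((ij.2 < k)%N || (ij.2 == k :> nat) && (ij.1 < m)%N)]%SET.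

Local Notation F k m := (g_sigma_algebraType (cylinders X (entries k m))).

Lemma entries_sub (i k m : nat) : (i < k)%N -> entries i.+1 0 \subset entries k m.
Proof.
move=> ik; apply/fintype.subsetP => -[p q]; rewrite !inE/= ltn0 andbF orbF ltnS.
by move=> /andP[-> qi]; rewrite (leq_ltn_trans qi ik).
Qed.

Lemma entries_sub0 (k m : nat) : entries k 0 \subset entries k m.
Proof.
apply/fintype.subsetP => -[p q]; rewrite !inE/= ltn0 andbF orbF.
by move=> /andP[-> ->].
Qed.

Lemma measurable_entry k m (i j : 'I_n.+1) : (i < j)%N ->
  (j < k)%N || (j == k :> nat) && (i < m)%N ->
  measurable_fun [set: F k m] (fun w => reim (T w i j)).
Proof.
by move=> ij H; apply: (measurable_cylinders_in X (i := (i, j))); rewrite inE/= ij.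
Qed.

Lemma measurable_b (k : 'I_n.+1) : measurable_fun [set: F k.+1 0] (fun w => reim (b k w)).
Proof.
have [m] := ubnP k; elim: m k => // m IH k; rewrite ltnS => km.
have [->|k0] := eqVneq k ord0.
  by rewrite (funext (fun w => congr1 _ (b0 w))); exact: measurable_cst.
rewrite (funext (fun w => congr1 _ (b_rec w k k0))).
apply: measurable_reimM; first exact: measurable_reim_cst.
apply: measurable_reim_sum => i ik; apply: measurable_reimM.
  apply: (measurable_cylinders_subset X (J := entries i.+1 0)).
    by apply: entries_sub; rewrite ltnS ltnW.
  by apply: IH; exact: leq_trans km.
by apply: measurable_entry => //; rewrite ltnSn.
Qed.

Lemma measurable_b_entries k m (i : 'I_n.+1) : (i < k)%N ->
  measurable_fun [set: F k m] (fun w => reim (b i w)).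
Proof.
move=> ik; apply: (measurable_cylinders_subset X (J := entries i.+1 0)).
  exact: entries_sub.
exact: measurable_b.
Qed.

(** This is [S_m]: indices now start at 0, whence the strict bound. *)
Definition partial_norm m w : R := \sum_(i < n.+1 | (i < m)%N) Normc.normc (b i w) ^+ 2.

Definition partial_comb (k : 'I_n.+1) m w : R[i] :=
  \sum_(i < n.+1 | (i < m)%N) b i w * T w i k.

Lemma partial_norm_ge0 m w : 0 <= partial_norm m w.
Proof. by apply: sumr_ge0 => i _; exact: sqr_ge0. Qed.

Lemma sum_ltnS (V : zmodType) (G : 'I_n.+1 -> V) (m : 'I_n.+1) :
  \sum_(i < n.+1 | (i < m.+1)%N) G i = \sum_(i < n.+1 | (i < m)%N) G i + G m.
Proof.
rewrite (bigD1 m) ?ltnSn//= addrC; congr (_ + _); apply: eq_bigl => i.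
by rewrite ltnS (ltn_neqAle i m) andbC.
Qed.

Lemma measurable_partial_norm k l m : (m <= k)%N ->
  measurable_fun [set: F k l] (partial_norm m).
Proof.
move=> mk; rewrite [X in measurable_fun _ X](_ : _ = (fun w =>
    \sum_(i < n.+1) if (i < m)%N then Normc.normc (b i w) ^+ 2 else 0)); last first.
  by apply/funext => w; rewrite /partial_norm big_mkcond.
apply: measurable_sum => i; case im : (i < m)%N; last exact: measurable_cst.
by apply: measurable_sqr_normc; apply: measurable_b_entries; exact: leq_trans mk.
Qed.

Lemma measurable_partial_comb (k : 'I_n.+1) m : (m <= k)%N ->
  measurable_fun [set: F k m] (fun w => reim (partial_comb k m w)).
Proof.
move=> mk; apply: measurable_reim_sum => i im; apply: measurable_reimM.
  by apply: measurable_b_entries; exact: leq_trans mk.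
apply: measurable_entry; first exact: leq_trans mk.
by rewrite eqxx im orbT.
Qed.

(** Given the columns before [k], the combination has the law of [Num.sqrt (partial_norm m)] times a
    Gaussian of parameter [s]. Letting [g] depend on [w] through these columns expresses the
    conditioning. Entries of column [k] are integrated out one by one, from the last. *)
Lemma ge0_integral_partial_comb (k : 'I_n.+1) m (g : Omega -> R * R -> \bar R) :
  (m <= k)%N ->
  measurable_fun [set: F k 0 * (R * R)] (fun z => g z.1 z.2) ->
  (forall w z, 0 <= g w z)%E ->
  (\int[P]_w g w (reim (partial_comb k m w)) =
   \int[P]_w \int[gauss s]_z
     g w (Num.sqrt (partial_norm m w) * z.1, Num.sqrt (partial_norm m w) * z.2)%R)%E.
Proof.
elim: m g => [|m IH] g mk mg g0.
  apply: eq_integral => w _; rewrite /partial_norm /partial_comb !big_pred0//.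
  rewrite sqrtr0; under eq_integral do rewrite !mul0r.
  by rewrite integral_cst// [X in (_ * X)%E](probability_setT (gauss s)) mule1.
have mltn : (m < n.+1)%N by rewrite (leq_trans mk)// ltnW.
pose i := Ordinal mltn.
have ik : (i < k)%N by [].
(* [c] stands for the combination of the first [m] entries and [t] for the next entry, which is
   multiplied by [b i]. *)
pose g' w (c t : R * R) : \bar R :=
  g w (c.1 + ((reim (b i w)).1 * t.1 - (reim (b i w)).2 * t.2),
       c.2 + ((reim (b i w)).2 * t.1 + (reim (b i w)).1 * t.2)).
transitivity (\int[P]_w g' w (reim (partial_comb k m w)) (reim (T w i k)))%E.
  by apply: eq_integral => w _; rewrite /partial_comb (sum_ltnS _ _ i) reimD reimM.
have mb K : measurable_fun [set: F k K] (fun w => reim (b i w)).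
  exact: measurable_b_entries.
have mg' : measurable_fun [set: F k 0 * (R * R) * (R * R)]
    (fun z => g' z.1.1 z.1.2 z.2).
  rewrite /g'; apply: (measurableT_comp mg (g := fun z : F k 0 * (R * R) * (R * R) => (z.1.1,
    (z.1.2.1 + ((reim (b i z.1.1)).1 * z.2.1 - (reim (b i z.1.1)).2 * z.2.2),
     z.1.2.2 + ((reim (b i z.1.1)).2 * z.2.1 + (reim (b i z.1.1)).1 * z.2.2))))).
  measurable_arith; by [apply: (measurableT_comp (mb 0)); measurable_arith].
have mc := measurable_partial_comb k m (ltnW mk).
have mgk : measurable_fun [set: F k m * (R * R)] (fun z => g z.1 z.2).
  have mid : measurable_fun [set: F k m] (fun w : F k m => (w : F k 0)).
    by apply: (measurable_cylinders_subset X (entries_sub0 k m)); exact: measurable_id.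
  apply: (measurableT_comp mg (g := fun z : F k m * (R * R) => ((z.1 : F k 0), z.2))).
  apply: measurable_fun_pair => //.
  exact: (measurableT_comp mid measurable_fst).
have mgc : measurable_fun [set: F k m * (R * R)]
    (fun z => g' z.1 (reim (partial_comb k m z.1)) z.2).
  rewrite /g'; apply: (measurableT_comp mgk (g := fun z : F k m * (R * R) => (z.1,
    ((reim (partial_comb k m z.1)).1 +
       ((reim (b i z.1)).1 * z.2.1 - (reim (b i z.1)).2 * z.2.2),
     (reim (partial_comb k m z.1)).2 +
       ((reim (b i z.1)).2 * z.2.1 + (reim (b i z.1)).1 * z.2.2))))).
  measurable_arith; by [apply: (measurableT_comp mc); measurable_arith|
    apply: (measurableT_comp (mb m)); measurable_arith].
(* Everything else in the integrand is determined by [entries k m], so the entry [(i, k)] can be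
   replaced by an independent Gaussian. *)
apply: (etrans (ge0_integral_cylinders _ _ _ P _ _ _ _ X mX indX (entries k m) (i, k)
  (gauss s) (fun w t => g' w (reim (partial_comb k m w)) t) _ _ _ _ mgc _)).
- by move=> ij; rewrite inE => /andP[].
- by [].
- by rewrite inE/= !ltnn eqxx/= andbF.
- by move=> A mA; exact: lawX.
- by move=> w t; exact: g0.
have mG : measurable_fun [set: F k 0 * (R * R)]
    (fun z => \int[gauss s]_t g' z.1 z.2 t)%E.
  apply: (measurable_integral2 _ (F k 0 * (R * R))%type _ _ (gauss s)
    (fun z t => g' z.1 z.2 t)); first exact: mg'.
  by move=> z t; exact: g0.
(* After averaging over [t], only [c] involves column [k], since [b i] comes from earlier
   columns. *)
apply: (etrans (IH (fun w c => \int[gauss s]_t g' w c t)%E (ltnW mk) mG _)).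
  by move=> w c; apply: integral_ge0 => t _; exact: g0.
apply: eq_integral => w _; rewrite /g'.
have mgw : measurable_fun [set: R * R] (g w).
  have mw : measurable_fun [set: R * R] (fun z : R * R => ((w : F k 0), z)).
    by apply: measurable_fun_pair; [exact: measurable_cst|exact: measurable_id].
  exact: (measurableT_comp mg mw).
(* The two Gaussians combine: [partial_norm m] and the squared modulus of [b i] add up to
   [partial_norm m.+1]. *)
apply: ge0_integral_gauss_lin => //.
rewrite !sqr_sqrtr ?partial_norm_ge0// -sqr_normc_reim.
by rewrite /partial_norm (sum_ltnS _ _ i).
Qed.

Lemma ge0_integral_partial_normS (k : 'I_n.+1) (h : R -> \bar R) : k != ord0 ->
  measurable_fun [set: R] h -> (forall x, 0 <= h x)%E ->
  (\int[P]_w h (partial_norm k.+1 w) = \int[P]_w \int[gauss s]_z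
     h (partial_norm k w *
        (1 + (z.1 ^+ 2 + z.2 ^+ 2) / Normc.normc (lambda k) ^+ 2))%R)%E.
Proof.
move=> k0 mh h0; set q := Normc.normc (lambda k) ^+ 2.
pose g w (z : R * R) := h (partial_norm k w + (z.1 ^+ 2 + z.2 ^+ 2) / q).
transitivity (\int[P]_w g w (reim (partial_comb k k w)))%E.
  apply: eq_integral => w _; rewrite /g -sqr_normc_reim; congr h.
  rewrite /partial_norm (sum_ltnS _ _ k) b_rec// Normc.normcM Normc.normcV.
  by rewrite exprMn exprVn mulrC.
have mS := measurable_partial_norm k 0 k (leqnn k).
have mg : measurable_fun [set: F k 0 * (R * R)] (fun z => g z.1 z.2).
  rewrite /g; apply: (measurableT_comp mh).
  measurable_arith; by apply: (measurableT_comp mS); measurable_arith.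
apply: (etrans (ge0_integral_partial_comb k k g (leqnn k) mg (fun w z => h0 _))).
apply: eq_integral => w _; apply: eq_integral => z _; rewrite /g/=; congr h.
rewrite !exprMn sqr_sqrtr ?partial_norm_ge0//; ring.
Qed.

End schur_recursion.

(** * The same recursion for the product of independent factors *)

Section independent_product.
Context d (Omega : measurableType d) (R : realType) (Q : probability Omega R).
Variables (n : nat) (X : 'I_n.+1 -> Omega -> R[i]) (c : 'I_n.+1 -> R).
Let D (k : 'I_n.+1) := k != ord0.
Hypothesis gaussX : forall k, D k -> standard_complex_gaussian Q (X k).
Hypothesis indX : mutually_independent Q D (fun k w => reim (X k w)).
Let Y k w := reim (X k w).

Definition factors (m : nat) : {set 'I_n.+1} :=
  [set k : 'I_n.+1 | (k != ord0) && (k < m)%N]%SET.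

Definition partial_prod m w : R :=
  \prod_(k < n.+1 | (k != ord0) && (k < m)%N) (1 + Normc.normc (X k w) ^+ 2 / c k).

Lemma measurable_factor (p : pred 'I_n.+1) :
  (forall k, p k -> D k) ->
  measurable_fun [set: Omega]
    (fun w => \prod_(k < n.+1 | p k) (1 + Normc.normc (X k w) ^+ 2 / c k)).
Proof.
move=> pD.
rewrite [X in measurable_fun _ X](_ : _ = (fun w => \prod_(k < n.+1)
    if p k then 1 + Normc.normc (X k w) ^+ 2 / c k else 1)); last first.
  by apply/funext => w; rewrite big_mkcond.
apply: measurable_prod => k _; case pk : (p k); last exact: measurable_cst.
have /standard_complex_gaussianE[mX _] := gaussX _ (pD _ pk).
apply: measurable_funD => //; apply: measurable_funM => //.
exact: measurable_sqr_normc.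
Qed.

Lemma measurable_partial_prod m :
  measurable_fun [set: g_sigma_algebraType (cylinders Y (factors m))]
    (partial_prod m).
Proof.
rewrite [X in measurable_fun _ X](_ : _ = (fun w => \prod_(k < n.+1)
    if (k != ord0) && (k < m)%N then 1 + Normc.normc (X k w) ^+ 2 / c k else 1)); last first.
  by apply/funext => w; rewrite /partial_prod big_mkcond.
apply: measurable_prod => k _; case km : ((k != ord0) && (k < m)%N);
  last exact: measurable_cst.
apply: measurable_funD => //; apply: measurable_funM => //.
by apply: measurable_sqr_normc; apply: (measurable_cylinders_in Y); rewrite inE km.
Qed.

Lemma prod_ltnS (F : 'I_n.+1 -> R) (k : 'I_n.+1) : k != ord0 ->
  \prod_(i < n.+1 | (i != ord0) && (i < k.+1)%N) F i =
  \prod_(i < n.+1 | (i != ord0) && (i < k)%N) F i * F k.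
Proof.
move=> k0; rewrite (bigD1 k) ?k0 ?ltnSn//= mulrC; congr (_ * _); apply: eq_bigl => i.
by rewrite ltnS (ltn_neqAle i k) -andbA [X in _ && X]andbC.
Qed.

Lemma ge0_integral_partial_prodS (k : 'I_n.+1) (h : R -> \bar R) : k != ord0 ->
  measurable_fun [set: R] h -> (forall x, 0 <= h x)%E ->
  (\int[Q]_w h (partial_prod k.+1 w) = \int[Q]_w \int[gauss (Num.sqrt 2)^-1]_z
     h (partial_prod k w * (1 + (z.1 ^+ 2 + z.2 ^+ 2) / c k))%R)%E.
Proof.
move=> k0 mh h0.
pose g w (z : R * R) := h (partial_prod k w * (1 + (z.1 ^+ 2 + z.2 ^+ 2) / c k)).
transitivity (\int[Q]_w g w (Y k w))%E.
  by apply: eq_integral => w _; rewrite /g -sqr_normc_reim /partial_prod prod_ltnS.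
have mY i : D i -> measurable_fun [set: Omega] (Y i).
  by move=> /gaussX/standard_complex_gaussianE[].
rewrite (ge0_integral_cylinders _ _ _ Q _ _ _ _ Y mY indX (factors k) k
  (gauss (Num.sqrt 2)^-1) g)//.
- by move=> i; rewrite inE => /andP[].
- by rewrite inE ltnn andbF.
- by move=> A mA; have /standard_complex_gaussianE[_] := gaussX k k0; exact.
- have mS := measurable_partial_prod k.
  rewrite /g; apply: (measurableT_comp mh).
  measurable_arith; by apply: (measurableT_comp mS); measurable_arith.
- by move=> w z; exact: h0.
Qed.

End independent_product.

(** * Comparison of the two recursions *)

Arguments partial_norm {d Omega R n} b m w.
Arguments partial_prod {d Omega R n} X c m w.

(** Both integrals are rescaled to [gauss 1]; the variances [1 / (2 N)] and [1 / 2] differ by the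
    factor [N = n.+1] placed in the denominator. *)
Lemma ge0_integral_gauss_factor (R : realType) (n : nat) (x q : R) (h : R -> \bar R) :
  measurable_fun [set: R] h -> (forall y, 0 <= h y)%E ->
  (\int[gauss (Num.sqrt (n.+1%:R *+ 2)^-1)]_z
     h (x * (1 + (z.1 ^+ 2 + z.2 ^+ 2) / q))%R =
   \int[gauss (Num.sqrt 2)^-1]_z
     h (x * (1 + (z.1 ^+ 2 + z.2 ^+ 2) / (n.+1%:R * q)))%R)%E.
Proof.
move=> mh h0.
pose G c (z : R * R) := h (x * (1 + (z.1 ^+ 2 + z.2 ^+ 2) / c))%R.
have mG c : measurable_fun [set: R * R] (G c).
  by apply: (measurableT_comp mh); measurable_arith.
have t2 : Num.sqrt (n.+1%:R *+ 2)^-1 ^+ 2 = (Num.sqrt 2)^-1 ^+ 2 / n.+1%:R :> R.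
  rewrite exprVn !sqr_sqrtr// ?invr_ge0 ?mulrn_wge0//.
  by rewrite -[_ *+ 2]mulr_natr invfM mulrC.
have t0 : 0 < Num.sqrt (n.+1%:R *+ 2)^-1 :> R.
  by rewrite sqrtr_gt0 invr_gt0 pmulrn_lgt0.
have t0' : 0 < (Num.sqrt 2)^-1 :> R by rewrite invr_gt0 sqrtr_gt0.
apply: (etrans (ge0_integral_gauss_scale _ (G q) t0 (mG q) (fun=> h0 _))).
apply: (etrans _ (esym (ge0_integral_gauss_scale _ (G _) t0' (mG _) (fun=> h0 _)))).
rewrite /G.
apply: eq_integral => z _ /=; congr h.
rewrite !exprMn t2 invfM; ring.
Qed.

Theorem theorem2p2 (R : realType) (n : nat) (lam : 'I_n.+1 -> R[i])
  (lam_distinct : injective lam)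
  (d : measure_display) (Omega : measurableType d) (P : probability Omega R)
  (T : Omega -> 'M[R[i]]_n.+1)
  (T_schur : ginibre_schur_form P lam T)
  (Rv Lv : Omega -> 'I_n.+1 -> 'cV[R[i]]_n.+1)
  (RvLv_eigen : forall omega : Omega,
     biorthogonal_eigenvectors (T omega) lam (Rv omega) (Lv omega))
  (d' : measure_display) (Omega' : measurableType d')
  (Q : probability Omega' R)
  (X : 'I_n.+1 -> Omega' -> R[i])
  (X_gauss : forall k : 'I_n.+1, k != ord0 -> standard_complex_gaussian Q (X k))
  (X_indep : mutually_independent Q (fun k : 'I_n.+1 => k != ord0)
     (fun k omega => reim (X k omega))) :
  eq_in_law P Q
    (fun omega => diagonal_overlap (Rv omega) (Lv omega) ord0)
    (fun omega => \prod_(k < n.+1 | k != ord0)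
       (1 + Normc.normc (X k omega) ^+ 2 /
            (n.+1%:R * Normc.normc (lam ord0 - lam k) ^+ 2))).
Proof.
have [Tdiag Ttriang Tlaw Tindep] := T_schur.
pose s : R := Num.sqrt (n.+1%:R *+ 2)^-1.
have s0 : s != 0 by rewrite gt_eqF// sqrtr_gt0 invr_gt0 pmulrn_lgt0.
pose lambda k := lam ord0 - lam k.
pose c k := n.+1%:R * Normc.normc (lambda k) ^+ 2.
pose b i w := left_ratio n (Rv w) (Lv w) i.
pose Y (ij : 'I_n.+1 * 'I_n.+1) w := reim (T w ij.1 ij.2).
have mY (ij : 'I_n.+1 * 'I_n.+1) : (ij.1 < ij.2)%N -> measurable_fun [set: Omega] (Y ij).
  by move=> /Tlaw[].
have lawY (ij : 'I_n.+1 * 'I_n.+1) : (ij.1 < ij.2)%N -> forall A, measurable A ->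
    P (Y ij @^-1` A) = gauss s A.
  by move=> /Tlaw[_ H] A mA; rewrite -ginibre_gauss// -H.
have b0 w : b ord0 w = 1.
  by apply: (left_ratio0 n lam lam_distinct (T w)) => //; exact: Ttriang.
have b_rec w k : k != ord0 ->
    b k w = (lambda k)^-1 * \sum_(i < n.+1 | (i < k)%N) b i w * T w i k.
  by apply: (left_ratio_rec n lam lam_distinct (T w)) => //; exact: Ttriang.
have overlapE : (fun w => diagonal_overlap (Rv w) (Lv w) ord0) =
    partial_norm b n.+1.
  apply/funext => w.
  rewrite (overlap_left_ratio n lam lam_distinct (T w))//; last exact: Ttriang.
  by rewrite /partial_norm; apply: eq_bigl => i; rewrite ltn_ord.
have prodE : (fun w => \prod_(k < n.+1 | k != ord0)
    (1 + Normc.normc (X k w) ^+ 2 /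
       (n.+1%:R * Normc.normc (lam ord0 - lam k) ^+ 2))) = partial_prod X c n.+1.
  apply/funext => w; rewrite /partial_prod; apply: eq_bigl => k.
  by rewrite ltn_ord andbT.
rewrite prodE overlapE.
have mS : measurable_fun [set: Omega] (partial_norm b n.+1).
  (* With bound [n.+1] all columns are read, and the sigma-algebra they generate is contained in
     that of [Omega]. *)
  have sub : cylinders Y (entries n n.+1 0) `<=` measurable.
    by apply: (cylinders_measurable _ _ _ _ _ _ _ mY) => ij; rewrite inE => /andP[].
  move=> _ A mA.
  have := measurable_partial_norm _ _ _ _ _ _ _ b0 b_rec n.+1 0 n.+1 (leqnn _) measurableT A mA.
  exact: (smallest_sub (@sigma_algebra_measurable _ Omega) sub).
have mP : measurable_fun [set: Omega'] (partial_prod X c n.+1).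
  by apply: (measurable_factor _ _ _ _ _ _ _ X_gauss) => k /andP[].
(* [h] stays general in the induction, because the hypothesis is applied to [H], the average of [h]
   over the new factor. *)
have main k (h : R -> \bar R) : (k <= n)%N ->
    measurable_fun [set: R] h -> (forall x, 0 <= h x)%E ->
    (\int[P]_w h (partial_norm b k.+1 w) =
     \int[Q]_w h (partial_prod X c k.+1 w))%E.
  elim: k h => [|k IH] h kn mh h0.
    have S1 w : partial_norm b 1 w = 1.
      rewrite /partial_norm (sum_ltnS _ _ _ ord0) big_pred0// add0r b0.
      by rewrite Normc.normc1 expr1n.
    have P1 w : partial_prod X c 1 w = 1.
      rewrite /partial_prod big_pred0// => i; case: eqVneq => //= /negPf.
      by rewrite -val_eqE/= ltnS leqn0.
    under eq_integral do rewrite S1; under [RHS]eq_integral do rewrite P1.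
    rewrite !integral_cst// [X in (_ * X)%E = _](probability_setT P).
    by rewrite [X in _ = (_ * X)%E](probability_setT Q).
  have kn' : (k.+1 < n.+1)%N by [].
  pose kk := Ordinal kn'.
  have kk0 : kk != ord0 by [].
  rewrite (ge0_integral_partial_normS _ _ _ P _ _ _ _ _ s0 mY lawY Tindep b0 b_rec kk h kk0 mh h0).
  pose q := Normc.normc (lambda kk) ^+ 2.
  pose H x := (\int[gauss s]_z h (x * (1 + (z.1 ^+ 2 + z.2 ^+ 2) / q))%R)%E.
  have mH : measurable_fun [set: R] H.
    rewrite /H; apply: (measurable_integral2 _ _ _ _ (gauss s)
      (fun (x : R) (z : R * R) => h (x * (1 + (z.1 ^+ 2 + z.2 ^+ 2) / q)))) => //.
    by apply: (measurableT_comp mh); measurable_arith.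
  rewrite (IH H (ltnW kn) mH); last by move=> x; apply: integral_ge0.
  rewrite (ge0_integral_partial_prodS _ _ _ Q _ _ c X_gauss X_indep kk h kk0 mh h0).
  apply: eq_integral => w _; exact: ge0_integral_gauss_factor.
split => // A mA.
have indicE d0 (E : measurableType d0) (p : probability E R) (f : E -> R) :
    measurable_fun [set: E] f ->
    (\int[p]_w (\1_A (f w))%:E = p (f @^-1` A))%E.
  move=> mf; have mfA : measurable (f @^-1` A).
    by rewrite -[X in measurable X]setTI; exact: mf.
  by rewrite -[in RHS](setIT (f @^-1` A)) -integral_indic.
rewrite -(indicE _ _ P) // -(indicE _ _ Q) //.
(* Indicator test functions turn equal integrals into equal laws. *)
apply: (main n (fun x => (\1_A x)%:E)) => //.
  by apply/measurable_EFinP; exact: measurable_indic.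
Qed.
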